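(* Let $m\ge 3$ be an integer, let $G=K_2 \Box P_m$, and let $n(G)=|V(G)|$. Then $\mathrm{DOM}_t(K_2 \Box P_m) \leq \left\lceil \frac{5}{6}n(G) \right\rceil$.
   Context: An orientation of a (finite simple) graph $G$ is a digraph obtained by directing each edge $uv$ of $G$ in exactly one of the two directions $(u,v)$ or $(v,u)$. The orientation is valid if every vertex has in-degree at least $1$. A set $S\subseteq V(D)$ is a total dominating set of a digraph $D$ if every vertex of $D$ (including those in $S$) has an in-neighbor in $S$; $\gamma_t(D)$ is the minimum cardinality of a total dominating set of $D$. For a graph $G$ in which every component contains a cycle (equivalently, $G$ has a valid orientation), $\mathrm{DOM}_t(G)$ is the maximum of $\gamma_t(D)$ over all valid orientations $D$ of $G$. $P_m$ is the path on $m$ vertices, $K_2$ is the complete graph on two vertices, and $G\Box H$ is the Cartesian product: vertex set $V(G)\times V(H)$, with $(g,h)$ adjacent to $(g',h')$ iff either $g=g'$ and $hh'\in E(H)$, or $gg'\in E(G)$ and $h=h'$. *)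

(* Defs.v *)
From mathcomp Require Import all_boot all_order all_algebra.

Set Implicit Arguments.
Unset Strict Implicit.
Unset Printing Implicit Defensive.

Record sgraph := SGraph {
  vertex :> finType;
  adj : rel vertex;
  adj_sym : symmetric adj;
  adj_irrefl : irreflexive adj
}.

Section Complete.
Variable n : nat.
Definition complete_rel : rel 'I_n := fun i j => i != j.
Lemma complete_sym : symmetric complete_rel.
Proof. by move=> i j; rewrite /complete_rel eq_sym. Qed.
Lemma complete_irrefl : irreflexive complete_rel.
Proof. by move=> i; rewrite /complete_rel eqxx. Qed.
Definition complete_graph : sgraph := SGraph complete_sym complete_irrefl.
End Complete.

Section Path.
Variable m : nat.
Definition path_rel : rel 'I_m := fun i j => (i.+1 == j) || (j.+1 == i).
Lemma path_sym : symmetric path_rel.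
Proof. by move=> i j; rewrite /path_rel orbC. Qed.
Lemma path_irrefl : irreflexive path_rel.
Proof. by move=> i; rewrite /path_rel orbb gtn_eqF. Qed.
Definition path_graph : sgraph := SGraph path_sym path_irrefl.
End Path.

Section Cartesian.
Variables G H : sgraph.
Definition cartesian_rel : rel (G * H) := fun x y =>
  ((x.1 == y.1) && adj x.2 y.2) || (adj x.1 y.1 && (x.2 == y.2)).
Lemma cartesian_sym : symmetric cartesian_rel.
Proof.
by move=> x y; rewrite /cartesian_rel (eq_sym x.1) (eq_sym x.2)
  (adj_sym x.1) (adj_sym x.2).
Qed.
Lemma cartesian_irrefl : irreflexive cartesian_rel.
Proof. by move=> x; rewrite /cartesian_rel !adj_irrefl andbF. Qed.
Definition cartesian_product : sgraph := SGraph cartesian_sym cartesian_irrefl.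
End Cartesian.

(* A digraph on T is its set of arcs; (u, v) is the arc from u to v. *)
Section Digraph.
Variable T : finType.
Implicit Types (D : {set T * T}) (S : {set T}).

Definition valid D : bool := [forall v, exists u, (u, v) \in D].

Definition total_dominating D S : bool :=
  [forall v, exists u in S, (u, v) \in D].

(* Meaningful when D is valid: otherwise no set is total dominating, and the
   value defaults to #|T|. *)
Definition gamma_t D : nat :=
  #|[arg min_(S < [set: T] | total_dominating D S) #|S|]|.

Lemma valid_total_dominating D : valid D = total_dominating D [set: T].
Proof. by apply: eq_forallb => v; apply: eq_existsb => u; rewrite inE. Qed.

End Digraph.

Definition orientation (G : sgraph) (D : {set G * G}) : bool :=
  [forall u : G, forall v : G,
     if adj u v then ((u, v) \in D) (+) ((v, u) \in D) else (u, v) \notin D].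

(* 0 when G has no valid orientation. *)
Definition DOM_t (G : sgraph) : nat :=
  \max_(D : {set G * G} | orientation D && valid D) gamma_t D.

(* Main.v *)
Require Import Defs.
From mathcomp Require Import all_boot all_order all_algebra.
From mathcomp Require Import zify lra.
Set Implicit Arguments.
Unset Strict Implicit.
Unset Printing Implicit Defensive.

Import Order.TTheory GRing.Theory Num.Theory.

(** Fix a valid orientation of the ladder with m columns of two vertices.  A
    total dominating set S is the complement of a set R of spared vertices
    such that no in-neighborhood lies inside R, and the bound asks for such an
    R of size at least floor (m / 3), since 2m - floor (m / 3) is at most the
    ceiling of 5m / 3.

    R is built column by column, from left to right, against an adversary who
    reveals the arcs.  Cut the ladder just before column j.  All that the right
    part needs to know of the left part is, for each of the two rows, one bit,
    which says that this row is secure.  If the arc of the row crosses the cut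
    rightwards, secure means that its tail is in S, so that the next vertex is
    already dominated; if it crosses leftwards, secure means that its head is
    already dominated, so that the next vertex is free to enter R.  A pair of
    bits and a size that some R on the left attains is called an option here.

    As a single choice of R cannot be right for every continuation, several
    options are kept alive at once: a profile is the pair of directions of the
    arcs that cross the cut, together with a list of options that all are
    attainable.  For the cut just after column j, counted from 0, a short list
    of profiles depending on j modulo 3 only, with sizes relative to
    floor (j / 3), is invariant: whatever the next column looks like, each
    profile leads to a listed one, and over three columns the sizes grow by
    one.  This is
    the finite check [table_steps_into]; [realized_move] says that a step of
    the finite game is a step on actual sets.

    At the right end the rails are continued by two arcs that leave the ladder.
    They dominate nothing inside, and all the listed profiles with two outgoing
    arcs provide floor (m / 3) spared vertices ([table_end]), which gives
    [sweep]; the last part translates this back to the graph. *)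

(** * The finite game *)

Definition entry (p : bool * bool) (r : bool) : bool := if r then p.2 else p.1.
Definition both (P : pred bool) : bool := P false && P true.
Definition pairs : seq (bool * bool) :=
  [:: (false, false); (false, true); (true, false); (true, true)].

Lemma bothP (P : pred bool) : reflect (forall r, P r) (both P).
Proof. by apply: (iffP andP) => [[? ?] [] //|PP]; split. Qed.

Lemma mem_pairs p : p \in pairs.
Proof. by case: p => [[] []]. Qed.

(** The vertex in row [r] of the new column is dominated from the left or along
    the rung, where [h] gives the directions of the arcs entering the column
    (true means rightwards), [s] the secure rows, [c] the spared vertices of
    the column and [t] the row of the head of its rung. *)
Definition fed (h s c : bool * bool) t r : bool :=
  (entry h r && entry s r) || ((r == t) && ~~ entry c (~~ r)).

(** The three conditions are, in this order: the last vertex of the previous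
    column, if still undominated, must be dominated by the new one; a vertex
    whose right arc goes out has no later chance to be dominated; and [s']
    claims only rows that are secure at the new cut. *)
Definition move t (h h' s c s' : bool * bool) : bool :=
  [&& both (fun r => [|| ~~ entry c r, entry h r | entry s r]),
      both (fun r => entry h' r ==> fed h s c t r) &
      both (fun r => entry s' r ==>
                     if entry h' r then ~~ entry c r else fed h s c t r)].

(** The directions at a cut, and the options (secure rows, size). *)
Definition profile : Type := (bool * bool) * seq ((bool * bool) * nat).

Definition mirror (P : profile) : profile :=
  let flip p := (p.2, p.1) in
  (flip P.1, [seq (flip o.1, o.2) | o <- P.2]).

Local Notation T := true (only parsing).
Local Notation F := false (only parsing).

(** The profiles needed after column [j], up to exchange of the two rows, where
    [p] is [j] modulo 3 and sizes are relative to the quotient.  They come from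
    collecting the Pareto-maximal options of every reachable profile, which
    repeat every three columns, and keeping only what closure under one step
    uses.  The first entry, for instance, means that if both arcs point back,
    some set exceeds the quotient by two, at the price that the next column
    must be kept entirely. *)
Definition half_table (p : nat) : seq profile :=
  match p with
  | 0 => [:: ((F, F), [:: ((F, F), 2)]);
             ((F, T), [:: ((F, F), 1); ((F, T), 0)]);
             ((T, T), [:: ((F, T), 0); ((T, F), 0)])]
  | 1 => [:: ((F, F), [:: ((F, F), 2)]);
             ((F, T), [:: ((F, F), 1); ((T, T), 0)]);
             ((F, T), [:: ((F, T), 1)]);
             ((T, T), [:: ((T, T), 0)])]
  | _ => [:: ((F, F), [:: ((T, F), 2)]);
             ((F, T), [:: ((T, F), 1); ((F, T), 1)]);
             ((F, T), [:: ((F, F), 2); ((F, T), 1)]);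
             ((T, T), [:: ((F, T), 1); ((T, T), 0)])]
  end%N.

Definition table p : seq profile := half_table p ++ map mirror (half_table p).

(** Both vertices of the new column have an in-neighbor: this is where validity
    of the orientation enters the game. *)
Definition admissible (h : bool * bool) t h' : bool :=
  both (fun r => [|| entry h r, r == t | ~~ entry h' r]).

(** Each option of [Q], shifted by the gain [g] of the quotient, comes from some
    option of [P] by some choice of the spared vertices; the choice may depend
    on the option aimed at. *)
Definition leads (g : nat) t (P Q : profile) : bool :=
  all (fun o' => has (fun o => has (fun c =>
    move t P.1 Q.1 o.1 c o'.1 && (g + o'.2 <= o.2 + (c.1 + c.2))%N) pairs) P.2) Q.2.

(** Virtual arcs into the empty left side make both rows secure at no cost. *)
Definition start : profile := ((false, false), [:: ((true, true), 0%N)]).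

Definition steps_into g (Ps Qs : seq profile) : bool :=
  all (fun P => all (fun t => all (fun h' =>
    admissible P.1 t h' ==> has (fun Q => (Q.1 == h') && leads g t P Q) Qs)
    pairs) [:: false; true]) Ps.

Lemma table_steps_into :
  [&& steps_into 0 [:: start] (table 0), steps_into 0 (table 0) (table 1),
      steps_into 0 (table 1) (table 2) & steps_into 1 (table 2) (table 0)].
Proof. by vm_compute. Qed.

(** After the last column of a group of three the quotient is about to increase,
    hence the extra spared vertex required for [p = 2]. *)
Lemma table_end p : (p < 3)%N -> all (fun P => (P.1 == (true, true)) ==>
   has (fun o => (p == 2) <= o.2)%N P.2) (table p).
Proof. by case: p => [|[|[|]]] //; vm_compute. Qed.

(** * From options to sets of spared vertices *)

(** [rung j] is the row of the head of the rung in column [j], and [rail r j]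
    says that the arc between columns [j.-1] and [j] of row [r] points right. *)
Section Sweep.
Variables (rung : nat -> bool) (rail : bool -> nat -> bool).
Hypothesis rail0 : forall r, rail r 0 = false.
Implicit Types (R : bool -> nat -> bool) (s c h : bool * bool).

(** Whether a vertex that is not settled gets dominated depends on its right
    neighbor alone. *)
Definition settled R r j : bool :=
  (rail r j && ~~ R r j.-1) || ((r == rung j) && ~~ R (~~ r) j).

(** All columns before the cut are dominated, except that a vertex of the last
    one may still wait for its right neighbor if the arc comes from there. *)
Definition feasible R j : Prop := forall r i, (i < j)%N ->
  settled R r i || (~~ rail r i.+1 && ((i.+1 == j) || ~~ R r i.+1)).

Definition secure R r j : bool :=
  if j is i.+1 then (if rail r j then ~~ R r i else settled R r i) else true.

Definition size_upto R j : nat := (\sum_(0 <= i < j) (R false i + R true i))%N.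

Definition cut j : bool * bool := (rail false j, rail true j).

Lemma entry_cut j r : entry (cut j) r = rail r j.
Proof. by case: r. Qed.

Definition realized j s x : Prop := exists R,
  [/\ feasible R j, forall r, entry s r -> secure R r j & (x <= size_upto R j)%N].

(** Spare [c] in column [j] on top of the given set.  Nothing that was settled
    before the cut changes, as it depends on earlier columns only; a vertex
    that was waiting for column [j] is dominated because [move] does not let
    its right neighbor be spared when the row is insecure. *)
Lemma realized_move j s x c s' :
  move (rung j) (cut j) (cut j.+1) s c s' -> realized j s x ->
  realized j.+1 s' (x + (c.1 + c.2)).
Proof.
move=> /and3P[/bothP c_ok /bothP fed_ok /bothP s_ok] [R [feasR secR leR]].
pose R' r i := if i == j then entry c r else R r i.
have R'j r : R' r j = entry c r by rewrite /R' eqxx.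
have R'lt r i : (i < j)%N -> R' r i = R r i by move=> ij; rewrite /R' ltn_eqF.
have settledlt r i : (i < j)%N -> settled R' r i = settled R r i.
  move=> ij; rewrite /settled !R'lt //; lia.
have settledj r : fed (cut j) s c (rung j) r -> settled R' r j.
  rewrite /fed /settled R'j entry_cut => /orP[/andP[rj sr]|->]; last by rewrite orbT.
  have j0 : (0 < j)%N by case: (j) rj => //; rewrite rail0.
  rewrite rj R'lt ?prednK //=; have := secR r sr.
  by case: (j) j0 rj => //= i _ ->  ->.
exists R'; split.
- move=> r i; rewrite ltnS leq_eqVlt => /predU1P[->|ij].
    rewrite eqxx andbT; have := fed_ok r; rewrite entry_cut.
    by case: (rail r j.+1); rewrite ?orbT //= => /settledj->.
  rewrite settledlt // eqSS (ltn_eqF ij) /=.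
  have := feasR r i ij; case: eqP => [ji|/eqP ji].
    subst j; rewrite R'j; have := c_ok r; rewrite entry_cut.
    have := secR r; rewrite /secure; case: (rail r i.+1) => //= secr.
    by case: (entry c r); rewrite /= ?orbT // => /secr ->.
  by rewrite R'lt //; lia.
- move=> r sr'; have := s_ok r; rewrite sr' /= entry_cut R'j.
  by case: ifP => // _ /settledj.
rewrite /size_upto big_nat_recr //= !R'j /entry leq_add2r.
apply: leq_trans leR _; rewrite /size_upto; apply/eq_leq.
by apply: eq_big_nat => i /andP[_ ij]; rewrite !R'lt.
Qed.

Definition realizes j b (P : profile) : Prop :=
  P.1 = cut j /\ forall o, o \in P.2 -> realized j o.1 (b + o.2).

Lemma realizes_leads j b g P Q : Q.1 = cut j.+1 -> leads g (rung j) P Q ->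
  realizes j b P -> realizes j.+1 (b + g) Q.
Proof.
move=> Qcut /allP PQ [Pcut realP]; split=> // o' /PQ/hasP[o oP /hasP[c _]].
rewrite Pcut Qcut => /andP[/realized_move/(_ (realP o oP))[R [feasR secR leR]] le_o'].
by exists R; split=> //; apply: leq_trans leR; rewrite -!addnA leq_add2l.
Qed.

Lemma realizes_start : realizes 0 0 start.
Proof.
split=> [|o]; first by rewrite /cut !rail0.
by rewrite inE => /eqP->; exists (fun _ _ => false).
Qed.

Section Length.
Variable m : nat.
Hypothesis m_gt0 : (0 < m)%N.
Hypothesis railm : forall r, rail r m = true.
Hypothesis indegree_gt0 : forall r j, (j < m)%N ->
  [|| rail r j, r == rung j | ~~ rail r j.+1].

Lemma realizes_step j b g (Ps Qs : seq profile) P : (j < m)%N -> steps_into g Ps Qs ->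
  P \in Ps -> realizes j b P -> exists2 Q, Q \in Qs & realizes j.+1 (b + g) Q.
Proof.
move=> jm /allP PQs /PQs/allP/(_ (rung j)) Pt Preal.
have /Pt/allP/(_ (cut j.+1) (mem_pairs _))/implyP Pth : rung j \in [:: false; true].
  by case: (rung j).
have /Pth/hasP[Q QQs /andP[/eqP Qcut PQ]] : admissible P.1 (rung j) (cut j.+1).
  by apply/bothP => r; case: Preal => -> _; rewrite !entry_cut indegree_gt0.
by exists Q => //; apply: realizes_leads PQ Preal.
Qed.

(** The quotient of [j] by 3 grows exactly at the steps from residue 2 to
    residue 0, which are those with gain 1 in [table_steps_into]. *)
Lemma realizes_table j : (j < m)%N ->
  exists2 P, P \in table (j %% 3) & realizes j.+1 (j %/ 3) P.
Proof.
have /and4P[c0 c01 c12 c20] := table_steps_into.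
elim: j => [|j IHj] jm.
  exact: (realizes_step jm c0 (mem_head _ _) realizes_start).
have [P Ptab Preal] := IHj (ltnW jm).
suff [g [cl /eqP ->]] : exists g, steps_into g (table (j %% 3)) (table (j.+1 %% 3)) /\
    j.+1 %/ 3 == j %/ 3 + g.
  exact: (realizes_step jm cl Ptab Preal).
have : (j %% 3 < 3)%N by rewrite ltn_mod.
case jp: (j %% 3) => [|[|[|//]]] _.
- by exists 0; rewrite (_ : j.+1 %% 3 = 1); [split=> //|]; lia.
- by exists 0; rewrite (_ : j.+1 %% 3 = 2); [split=> //|]; lia.
- by exists 1; rewrite (_ : j.+1 %% 3 = 0); [split=> //|]; lia.
Qed.

(** As both arcs at the right end point outwards, no vertex of the last column
    is left waiting, so that the partial domination becomes a full one. *)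
Lemma sweep : exists R,
  (forall r j, (j < m)%N -> settled R r j || (~~ rail r j.+1 && ~~ R r j.+1)) /\
  (m %/ 3 <= size_upto R m)%N.
Proof.
have m1 : m.-1 < m by rewrite prednK.
have [P Ptab [Pcut Preal]] := realizes_table m1.
have /table_end/allP/(_ P Ptab) : m.-1 %% 3 < 3 by rewrite ltn_mod.
move: Pcut; rewrite prednK // /cut !railm => -> /= /hasP[o /Preal].
rewrite prednK // => -[R [feasR _ leR]] le_o; exists R; split; last first.
  by move: (o.2) le_o leR => x; case: eqP => /= mod3 le_x leR; lia.
move=> r j jm; have := feasR r j jm; case: eqP => [->|//].
by rewrite railm.
Qed.

End Length.
End Sweep.

(** * Ladders *)

Definition ladder m : sgraph := cartesian_product (complete_graph 2) (path_graph m).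

Section Ladder.
Variable m : nat.
Notation G := (ladder m.+1).

Definition site (r : bool) (j : nat) : G := (if r then ord_max else ord0, inord j).

Definition coords (v : G) : bool * nat := (v.1 != ord0, v.2 : nat).

Lemma coordsK (v : G) : site (coords v).1 (coords v).2 = v.
Proof.
case: v => i k; rewrite /site /= inord_val; congr (_, _).
by apply/val_inj; case: i => [[|[|i]]] //= ilt; case: ifP.
Qed.

Lemma siteK r j : j <= m -> coords (site r j) = (r, j).
Proof. by move=> jm; rewrite /coords /site /= inordK //; case: r. Qed.

Lemma coords_lt (v : G) : (coords v).2 < m.+1.
Proof. exact: ltn_ord. Qed.

Lemma adj_site r j r' j' : j <= m -> j' <= m ->
  adj (site r j) (site r' j') =
  ((r == r') && ((j.+1 == j') || (j'.+1 == j))) || ((r != r') && (j == j')).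
Proof.
move=> jm j'm; rewrite /adj /= /cartesian_rel /= /complete_rel /path_rel !inordK //.
by rewrite -[inord j == _]val_eqE /= !inordK //; case: r; case: r'.
Qed.

Lemma card_kept (R : bool -> nat -> bool) :
  #|[set v : G | ~~ R (coords v).1 (coords v).2]| + size_upto R m.+1 = 2 * m.+1.
Proof.
rewrite -[RHS](_ : #|{: G}| = _); last by rewrite card_prod !card_ord.
rewrite -(cardC [set v : G | ~~ R (coords v).1 (coords v).2]); congr (_ + _).
rewrite -sum1_card big_mkcond /= /size_upto big_mkord.
rewrite (eq_bigr (fun v : G => (R (coords v).1 (coords v).2 : nat))); last first.
  by move=> v _; rewrite !inE negbK; case: (R _ _).
rewrite -(pair_bigA _ (fun i k => (R (coords (i, k)).1 (coords (i, k)).2 : nat))) /=.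
by rewrite [RHS]big_ord_recl big_ord1 big_split.
Qed.

Variable D : {set G * G}.
Hypothesis D_orient : orientation D.

Lemma arc_reverse (u v : G) : adj u v -> ((u, v) \in D) = ((v, u) \notin D).
Proof.
move=> uv; move/forallP/(_ u)/forallP/(_ v): D_orient; rewrite uv.
by case: (_ \in D); case: (_ \in D).
Qed.

Lemma arc_adj (u v : G) : (u, v) \in D -> adj u v.
Proof.
by move=> uvD; move/forallP/(_ u)/forallP/(_ v): D_orient; case: ifP; rewrite ?uvD.
Qed.

Definition rung_head j : bool := (site false j, site true j) \in D.

(** With the conventions of the sweep at the two ends: nothing enters from the
    left of column 0, and the arcs beyond column [m] leave the ladder. *)
Definition rail_right r j : bool :=
  (0 < j) && ((m < j) || ((site r j.-1, site r j) \in D)).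

Lemma arc_rung r j : j <= m -> r == rung_head j -> (site (~~ r) j, site r j) \in D.
Proof.
move=> jm /eqP->; have adj_j : adj (site false j) (site true j) by rewrite adj_site ?eqxx.
by case: (boolP (rung_head j)) => //=; rewrite /rung_head (arc_reverse adj_j) negbK.
Qed.

Lemma arc_right r j : j <= m -> rail_right r j -> (site r j.-1, site r j) \in D.
Proof. by move=> jm /andP[_]; rewrite ltnNge jm. Qed.

Lemma arc_left r j : j <= m -> ~~ rail_right r j.+1 ->
  j < m /\ (site r j.+1, site r j) \in D.
Proof.
rewrite /rail_right /= => jm; rewrite negb_or -leqNgt => /andP[jm'].
have adj_j : adj (site r j) (site r j.+1) by rewrite adj_site ?eqxx.
by rewrite (arc_reverse adj_j) negbK.
Qed.

(** An in-neighbor of a vertex sits on its left, on its right or on the same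
    rung; the last case means that the rung points to the vertex. *)
Lemma valid_site r j : valid D -> j < m.+1 ->
  [|| rail_right r j, r == rung_head j | ~~ rail_right r j.+1].
Proof.
move=> /forallP/(_ (site r j))/existsP[u]; rewrite ltnS -(coordsK u).
have := coords_lt u; case: (coords u) => r' j' /= j'm uD jm.
have := arc_adj uD; rewrite adj_site //.
case/orP=> [/andP[/eqP rr /orP[/eqP jj|/eqP jj]]|/andP[rr /eqP jj]].
- by move: uD; rewrite rr /rail_right -jj /= => ->; rewrite orbT.
- suff /negbTE-> : ~~ rail_right r j.+1 by rewrite !orbT.
  rewrite /rail_right /= jj ltnNge -ltnS j'm /=.
  by move: uD; rewrite arc_reverse ?rr // adj_site // eqxx jj eqxx orbT.
- suff -> : r == rung_head j by rewrite orbT.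
  have adj_j : adj (site false j) (site true j) by rewrite adj_site ?eqxx.
  move: uD; rewrite jj /rung_head; case: r r' rr => [] [] // _.
  by move=> uD; rewrite (arc_reverse adj_j) uD.
Qed.

Lemma gamma_t_le : valid D -> gamma_t D <= 2 * m.+1 - m.+1 %/ 3.
Proof.
move=> D_valid.
have [R [domR sizeR]] := @sweep rung_head rail_right (fun=> erefl) m.+1 isT
  (fun r => ltac:(by rewrite /rail_right ltnSn)) (fun r j => @valid_site r j D_valid).
pose S := [set v : G | ~~ R (coords v).1 (coords v).2].
have sS r j : j <= m -> (site r j \in S) = ~~ R r j.
  by move=> jm; rewrite inE siteK.
have S_dom : total_dominating D S.
  apply/forallP => v; rewrite -(coordsK v); have := coords_lt v.
  case: (coords v) => r j /= jm; apply/existsP.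
  have := domR r j jm; rewrite ltnS in jm.
  case/orP=> [/orP[]|] /andP[arc nR].
  - have jm' := leq_trans (leq_pred j) jm.
    by exists (site r j.-1); rewrite sS // nR arc_right.
  - by exists (site (~~ r) j); rewrite sS // nR arc_rung.
  - have [jm' arcD] := arc_left jm arc.
    by exists (site r j.+1); rewrite sS // nR.
have le_S : gamma_t D <= #|S|.
  rewrite /gamma_t; case: arg_minnP => [|S' _]; last exact.
  by rewrite -valid_total_dominating.
apply: leq_trans le_S _; have := card_kept R; rewrite -/S; lia.
Qed.

End Ladder.

(** * The bound *)

Local Open Scope ring_scope.

Theorem theorem4p9 (m : nat) (hm : (3 <= m)%N) :
  let G := cartesian_product (complete_graph 2) (path_graph m) in
  (DOM_t G)%:Z <= Num.ceil (5%:R / 6%:R * #|G|%:R : rat).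
Proof.
cbv zeta; rewrite card_prod !card_ord.
have le_dom : (DOM_t (ladder m) <= 2 * m - m %/ 3)%N.
  case: m hm => // m' _; apply/bigmax_leqP => D /andP[D_or D_val].
  exact: gamma_t_le.
(* floor (m / 3) >= (m - 2) / 3, and an integer below 5m / 3 + 1 is at most the ceiling. *)
have {le_dom} : (3 * DOM_t (ladder m) < 5 * m + 3)%N by lia.
rewrite -/(ladder m); move: (DOM_t _) => d le_d.
rewrite -ltzD1 -ltrBlDr ceil_gt_int.
have : d%:R * 3 < m%:R * 5 + 3 :> rat by rewrite -!natrM -natrD ltr_nat; lia.
rewrite rmorphB /= -pmulrn natrM; lra.
Qed.
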